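(* (Frobenius reciprocity II) Let $G$ be a finite group acting transitively on $X$, $H\le G$ a subgroup, $(\rho,W)$ a representation of $H$, and $\tau=\mathrm{Ind}_H^G\rho$. Let $S$ be a set of representatives with $G=\coprod_{s\in S}sH$ and $1_G\in S$. For $L\in\mathrm{Hom}_H(W,\mathrm{Res}_H^GL(X))$, define $\stackrel{\diamond}{L}$ by setting $$\left(\stackrel{\diamond}{L}\sum_{s\in S}\tau(s)w_s\right)(x)=\frac{1}{\sqrt{|S|}}\sum_{s\in S}(Lw_s)(s^{-1}x)$$ for every $\sum_{s\in S}\tau(s)w_s\in\mathrm{Ind}_H^GW$ and $x\in X$. Then $\stackrel{\diamond}{L}\in\mathrm{Hom}_G(\mathrm{Ind}_H^GW,L(X))$ and the map $$\mathrm{Hom}_H(W,\mathrm{Res}_H^GL(X))\longrightarrow\mathrm{Hom}_G(\mathrm{Ind}_H^GW,L(X)),\qquad L\longmapsto\stackrel{\diamond}{L}$$ is an isometric isomorphism.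
   Context: Representations are finite-dimensional, complex and unitary. $L(X)$ is the space of complex functions on $X$ with $\langle f_1,f_2\rangle=\sum_xf_1(x)\overline{f_2(x)}$ and permutation representation $(\lambda(g)f)(x)=f(g^{-1}x)$. $\mathrm{Ind}_H^GW$ is the space of all (uniquely written) formal sums $\sum_{s\in S}\tau(s)w_s$, $w_s\in W$, with $W$ identified with $\tau(1_G)W$, $\tau(g)\tau(s)w=\tau(s')\rho(h)w$ if $gs=s'h$ with $s'\in S$, $h\in H$, and inner product $\bigl\langle\sum_s\tau(s)w_s,\sum_s\tau(s)w_s'\bigr\rangle=\sum_s\langle w_s,w'_s\rangle$. The Hom spaces (intertwining operators) carry the Hilbert--Schmidt inner product $\langle A,B\rangle_{HS}=\sum_k\langle Au_k,Bu_k\rangle$, $(u_k)$ an orthonormal basis of the domain. *)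

(* Defs.v *)
From HB Require Import structures.
From mathcomp Require Import all_boot all_order all_algebra all_fingroup.
From mathcomp Require Import sesquilinear.

Set Implicit Arguments.
Unset Strict Implicit.
Unset Printing Implicit Defensive.

Import Order.TTheory GRing.Theory Num.Theory.
Local Open Scope ring_scope.

(* A finite-dimensional Hermitian space is a [vectType] together with a form
   [{dot V for Num.conj}], linear in the first variable. *)

Section OrthonormalBases.
Variables (C : numClosedFieldType) (V : vectType C) (form : {dot V for Num.conj}).

Definition orthonormal_basis (e : seq V) :=
  basis_of fullv e && orthonormal form e.

Lemma ex_orthonormal_basis : exists e, orthonormal_basis e.
Proof.
suff [e /andP[/eqP De oe]] : exists e, (<<e>>%VS == fullv) && orthonormal form e.
  by exists e; rewrite /orthonormal_basis /basis_of De eqxx (orthonormal_free oe).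
have [b Db] : exists b : seq V, <<b>>%VS = fullv.
  by exists (vbasis fullv); rewrite (span_basis (vbasisP _)).
rewrite -Db; elim: b {Db} => [|v b [e /andP[/eqP De oe]]].
  by exists [::]; rewrite eqxx.
have [x xe [y [Dv _ oy]]] := orthogonal_split form e v.
have vE : <<v :: b>>%VS = (<[y]> + <<e>>)%VS.
  rewrite span_cons -De Dv; apply/eqP; rewrite eqEsubv !subv_add !addvSr !andbT.
  rewrite -!memvE; apply/andP; split.
    by rewrite addrC memv_add // memv_line.
  have : (x + y) + - x \in (<[x + y]> + <<e>>)%VS.
    by rewrite memv_add ?memv_line ?memvN.
  by rewrite addrC addKr.
have [y0|y0] := eqVneq y 0.
  exists e; rewrite oe andbT vE y0; apply/eqP.
  by rewrite (_ : <[0]>%VS = 0%VS) ?add0v //; apply/eqP; rewrite -dimv_eq0 dim_vline eqxx.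
have n0 : sqrtC (form y y) != 0 by rewrite sqrt_dnorm_eq0.
exists ((sqrtC (form y y))^-1 *: y :: e).
rewrite vE span_cons; apply/andP; split.
  apply/eqP; congr (_ + _)%VS; apply/eqP; rewrite eqEsubv -!memvE.
  rewrite memvZ ?memv_line //=.
  by rewrite -{1}[y](scalerKV n0) memvZ // memv_line.
rewrite -cat1s orthonormal_cat oe; apply/and3P; split=> //.
  rewrite /orthonormal /= !andbT dnormZ ger0_norm ?invr_ge0 ?sqrt_dnorm_ge0 //.
  by rewrite exprVn sqrtCK mulVf // dnorm_eq0.
apply/(orthoPl (form := form)) => u ue; rewrite linearZl_LR /=.
by rewrite (orthoPl oy u ue) mulr0.
Qed.

Definition onb : seq V := xchoose ex_orthonormal_basis.

Lemma onbP : orthonormal_basis onb.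
Proof. exact: xchooseP. Qed.

Lemma orthonormal_basisE e v : orthonormal_basis e ->
  v = \sum_(u <- e) form v u *: u.
Proof.
case/andP=> be /orthonormalP[uniqe oe].
rewrite {1}(coord_basis (X := in_tuple e) be (memvf v)) (big_nth 0) big_mkord.
apply: eq_bigr => i _; congr (_ *: _).
rewrite {2}(coord_basis (X := in_tuple e) be (memvf v)) linear_sumlz /= (bigD1 i) //=.
rewrite linearZl_LR /= oe ?mem_nth // eqxx mulr1 big1 ?addr0 // => j ji.
by rewrite linearZl_LR /= oe ?mem_nth // nth_uniq // (inj_eq val_inj) (negPf ji) mulr0.
Qed.

End OrthonormalBases.

Section HilbertSchmidt.
Variables (C : numClosedFieldType) (U V : vectType C).
Variables (formU : {dot U for Num.conj}) (formV : {dot V for Num.conj}).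

Definition hs_dot (A B : 'Hom(U, V)) : C :=
  \sum_(u <- onb formU) formV (A u) (B u).

Lemma hs_dotE e A B : orthonormal_basis formU e ->
  hs_dot A B = \sum_(u <- e) formV (A u) (B u).
Proof.
move=> onbe; have onb0 := onbP formU.
have E u : A u = \sum_(w <- e) formU u w *: A w.
  by rewrite {1}(orthonormal_basisE u onbe) linear_sum; apply: eq_bigr => w _; rewrite linearZ.
rewrite /hs_dot (eq_bigr (fun u => \sum_(w <- e) formU u w * formV (A w) (B u))); last first.
  by move=> u _; rewrite E linear_sumlz; apply: eq_bigr => w _; rewrite linearZl_LR.
rewrite exchange_big /=; apply: eq_bigr => w _.
rewrite [in B w](orthonormal_basisE w onb0) linear_sum linear_sumr /=.
apply: eq_bigr => u _; rewrite linearZ linearZr_LR /=.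
by rewrite [formU w u]hermC mul1r conjCK.
Qed.

Fact hs_dot_bilinear : bilinear_for *%R (Num.conj \; *%R) hs_dot.
Proof.
split=> [B | A] a x y; rewrite /hs_dot /= mulr_sumr -big_split; apply: eq_bigr => u _.
  by rewrite lfunE /= lfunE /= linearPl.
by rewrite lfunE /= lfunE /= linearPr.
Qed.

HB.instance Definition _ := bilinear_isBilinear.Build C _ _ C
  *%R (Num.conj \; *%R) hs_dot hs_dot_bilinear.

Fact hs_dot_hermitian A B : hs_dot A B = (-1) ^+ false * Num.conj (hs_dot B A).
Proof.
rewrite mul1r /hs_dot rmorph_sum; apply: eq_bigr => u _.
by rewrite {1}hermC mul1r.
Qed.

HB.instance Definition _ :=
  isHermitianSesquilinear.Build C _ false Num.conj hs_dot hs_dot_hermitian.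

Fact hs_dot_gt0 A : A != 0 -> 0 < hs_dot A A.
Proof.
move=> A0; have ge0 u : 0 <= formV (A u) (A u) by [].
rewrite lt0r sumr_ge0 // andbT; apply: contraNneq A0.
move=> /eqP; rewrite psumr_eq0 // => /allP Au0; apply/eqP/lfunP => v.
rewrite (orthonormal_basisE v (onbP formU)) !linear_sum big_seq [RHS]big_seq.
apply: eq_bigr => u ub; rewrite !linearZ /= lfunE; congr (_ *: _).
by apply/eqP; rewrite -(dnorm_eq0 formV); apply: Au0.
Qed.

HB.instance Definition _ := isDotProduct.Build C _ hs_dot hs_dot_gt0.

End HilbertSchmidt.

Section FunctionSpaces.
Variable C : numClosedFieldType.

Definition scalar_dot (a b : C^o) : C := a * b^*.

Fact scalar_dot_bilinear : bilinear_for *%R (Num.conj \; *%R) scalar_dot.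
Proof.
split=> [b | b] a x y; rewrite /scalar_dot /=; first by rewrite mulrDl -mulrA.
by rewrite rmorphD rmorphM mulrDr mulrCA.
Qed.

HB.instance Definition _ := bilinear_isBilinear.Build C C^o C^o C
  *%R (Num.conj \; *%R) scalar_dot scalar_dot_bilinear.

Fact scalar_dot_hermitian a b :
  scalar_dot a b = (-1) ^+ false * Num.conj (scalar_dot b a).
Proof. by rewrite mul1r /scalar_dot rmorphM /= conjCK mulrC. Qed.

HB.instance Definition _ := isHermitianSesquilinear.Build C C^o false Num.conj
  scalar_dot scalar_dot_hermitian.

Fact scalar_dot_gt0 a : a != 0 -> 0 < scalar_dot a a.
Proof. by move=> a0; rewrite /scalar_dot mul_conjC_gt0. Qed.

HB.instance Definition _ := isDotProduct.Build C C^o scalar_dot scalar_dot_gt0.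

Variables (I : finType) (V : vectType C) (form : {dot V for Num.conj}).

Definition ffun_dot (f g : {ffun I -> V}) : C := \sum_i form (f i) (g i).

Fact ffun_dot_bilinear : bilinear_for *%R (Num.conj \; *%R) ffun_dot.
Proof.
split=> [g | f] a x y; rewrite /ffun_dot /= mulr_sumr -big_split; apply: eq_bigr => i _.
  by rewrite !ffunE linearPl.
by rewrite !ffunE linearPr.
Qed.

HB.instance Definition _ := bilinear_isBilinear.Build C _ _ C
  *%R (Num.conj \; *%R) ffun_dot ffun_dot_bilinear.

Fact ffun_dot_hermitian f g :
  ffun_dot f g = (-1) ^+ false * Num.conj (ffun_dot g f).
Proof.
rewrite mul1r /ffun_dot rmorph_sum; apply: eq_bigr => i _.
by rewrite {1}hermC mul1r.
Qed.

HB.instance Definition _ :=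
  isHermitianSesquilinear.Build C _ false Num.conj ffun_dot ffun_dot_hermitian.

Fact ffun_dot_gt0 f : f != 0 -> 0 < ffun_dot f f.
Proof.
move=> f0; have ge0 i : 0 <= form (f i) (f i) by [].
rewrite lt0r sumr_ge0 // andbT; apply: contraNneq f0.
move=> /eqP; rewrite psumr_eq0 // => /allP fi0; apply/eqP/ffunP => i.
by rewrite ffunE; apply/eqP; rewrite -(dnorm_eq0 form); apply: fi0; rewrite mem_index_enum.
Qed.

HB.instance Definition _ := isDotProduct.Build C _ ffun_dot ffun_dot_gt0.

End FunctionSpaces.

Notation fun_space C X := {ffun X -> C^o}.

(* The formal sum [\sum_(s in S) tau(s) w_s] is the family [s |-> w_s]. *)
Notation ind_space S W := {ffun {s | s \in S} -> W}.

Section Representations.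
Variables (C : numClosedFieldType) (G : finGroupType).

(* [rho] is only constrained on [H]; its values outside [H] are junk. *)
Definition unitary_repr (H : {set G}) (V : vectType C)
    (form : {dot V for Num.conj}) (rho : G -> 'End(V)) :=
  [/\ rho 1%g = \1%VF,
      {in H &, forall g h, rho (g * h)%g = (rho g \o rho h)%VF} &
      {in H, forall h, isometry form form (rho h)}].

(* [Hom_H(V1, V2)]; restriction to a subgroup only changes [H]. *)
Definition intertwiners (H : {set G}) (V1 V2 : vectType C)
    (rho1 : G -> 'End(V1)) (rho2 : G -> 'End(V2)) : {pred 'Hom(V1, V2)} :=
  [pred A | [forall h in H, (A \o rho1 h)%VF == (rho2 h \o A)%VF]].

Section PermutationRepresentation.
Variables (X : finType) (to : {action G &-> X}).

(* MathComp actions are right actions; this is the corresponding left one. *)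
Definition lact (g : G) (x : X) : X := to x g^-1%g.

Lemma lact1 x : lact 1 x = x.
Proof. by rewrite /lact invg1 act1. Qed.

Lemma lactM g h x : lact (g * h) x = lact g (lact h x).
Proof. by rewrite /lact invMg actM. Qed.

Definition perm_repr_fun (g : G) (f : fun_space C X) : fun_space C X :=
  [ffun x => f (lact g^-1%g x)].

Fact perm_repr_fun_linear g : linear (perm_repr_fun g).
Proof. by move=> a f1 f2; apply/ffunP => x; rewrite !ffunE. Qed.

HB.instance Definition _ g :=
  GRing.isLinear.Build C _ _ _ (perm_repr_fun g) (perm_repr_fun_linear g).

Definition perm_repr (g : G) : 'End(fun_space C X) := linfun (perm_repr_fun g).

Lemma perm_reprE g f x : perm_repr g f x = f (lact g^-1%g x).
Proof. by rewrite lfunE ffunE. Qed.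

End PermutationRepresentation.

Section InducedRepresentation.
Variables (H : {group G}) (S : {set G}).
Variables (W : vectType C) (rho : G -> 'End(W)).

(* The coefficient of [tau(s')] in [tau(g) (\sum_s tau(s) w_s)]: it collects the
   [rho(h) w_s] over those [s] with [g * s = s' * h] and [h \in H]. *)
Definition ind_repr_fun (g : G) (w : ind_space S W) : ind_space S W :=
  [ffun s' => \sum_(s | (g * val s)%g \in (val s' *: H)%g)
                rho ((val s')^-1 * g * val s)%g (w s)].

Fact ind_repr_fun_linear g : linear (ind_repr_fun g).
Proof.
move=> a w1 w2; apply/ffunP => s'; rewrite !ffunE scaler_sumr -big_split.
by apply: eq_bigr => s _; rewrite !ffunE linearP.
Qed.

HB.instance Definition _ g :=
  GRing.isLinear.Build C _ _ _ (ind_repr_fun g) (ind_repr_fun_linear g).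

Definition ind_repr (g : G) : 'End(ind_space S W) := linfun (ind_repr_fun g).

Definition ind_single (s : {s | s \in S}) (w : W) : ind_space S W :=
  [ffun t => if t == s then w else 0].

Lemma ind_repr_single g s s' h w :
    is_transversal S (lcosets H [set: G]) [set: G] -> h \in H ->
    (g * val s = val s' * h)%g ->
  ind_repr g (ind_single s w) = ind_single s' (rho h w).
Proof.
case/and3P=> _ _ /'forall_implyP trS hH gs.
have uniqS (t : {s | s \in S}) : ((g * val s)%g \in (val t *: H)%g) = (t == s').
  rewrite gs mem_lcoset mulgA groupMr // -mem_lcoset.
  apply/idP/eqP=> [tH | ->]; last exact: lcoset_refl.
  have /trS/cards1P[x Sx] : (val t *: H)%g \in lcosets H [set: G].
    by apply/lcosetsP; exists (val t); rewrite ?inE.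
  have xE y : y \in S -> y \in (val t *: H)%g -> y = x.
    by move=> yS yt; apply/set1P; rewrite -Sx inE yS.
  apply: val_inj; rewrite (xE _ (valP t) (lcoset_refl _ _)).
  by rewrite (xE _ (valP s') tH).
apply/ffunP => t; rewrite lfunE !ffunE.
rewrite (eq_bigl (fun u => ((g * val u)%g \in (val t *: H)%g))) //.
rewrite big_mkcond (bigD1 s) //= big1 ?addr0; last first.
  by move=> u /negPf us; rewrite ffunE us linear0 if_same.
rewrite ffunE eqxx uniqS; case: eqP => // ->.
by rewrite -mulgA gs mulKg.
Qed.

End InducedRepresentation.

Section Diamond.
Variables (X : finType) (to : {action G &-> X}) (S : {set G}).
Variables (W : vectType C).

Definition diamond_fun (L : 'Hom(W, fun_space C X)) (w : ind_space S W) :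
    fun_space C X :=
  [ffun x => (sqrtC #|S|%:R)^-1 * \sum_s L (w s) (lact to (val s)^-1%g x)].

Fact diamond_fun_linear L : linear (diamond_fun L).
Proof.
move=> a w1 w2; apply/ffunP => x; rewrite !ffunE scalerAr scaler_sumr -mulrDr -big_split.
by congr (_ * _); apply: eq_bigr => s _; rewrite !ffunE linearP !ffunE.
Qed.

HB.instance Definition _ L :=
  GRing.isLinear.Build C _ _ _ (diamond_fun L) (diamond_fun_linear L).

Definition diamond (L : 'Hom(W, fun_space C X)) :
  'Hom(ind_space S W, fun_space C X) := linfun (diamond_fun L).

Lemma diamondE L w x : diamond L w x =
  (sqrtC #|S|%:R)^-1 * \sum_s L (w s) (lact to (val s)^-1%g x).
Proof. by rewrite lfunE ffunE. Qed.

End Diamond.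

End Representations.
Arguments diamond {C G X} to S {W} L.

(* [D] and [E] are to be read as linear subspaces of [U] and [V]. *)
Definition isometric_isomorphism (C : numClosedFieldType) (U V : lmodType C)
    (formU : {dot U for Num.conj}) (formV : {dot V for Num.conj})
    (D : {pred U}) (E : {pred V}) (f : U -> V) :=
  [/\ {in D, forall u, f u \in E},
      forall a, {in D &, forall u v, f (a *: u + v) = a *: f u + f v},
      {in D &, injective f},
      forall v, v \in E -> exists2 u, u \in D & f u = v &
      {in D &, forall u v, formV (f u) (f v) = formU u v}].

(* Main.v *)
From HB Require Import structures.
Require Import Defs.
From mathcomp Require Import all_boot all_order all_algebra all_fingroup.
From mathcomp Require Import sesquilinear reals complex.

(** Write [iota_s w] for [ind_single s w], the formal sum with the single term
    [tau(s) w]. The copies [iota_s W] span the induced space and are mutually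
    orthogonal, and on each of them the lifted operator is
    [diamond L (iota_s w) = |S|^(-1/2) lambda(s) (L w)] ([diamond_single]).
    All the claims can be read off this formula.

    - [diamond L] intertwines: if [g s = s' h] with [h] in [H], then [tau(g)]
      sends [iota_s w] to [iota_s' (rho(h) w)], and
      [lambda(s') L rho(h) = lambda(s') lambda(h) L = lambda(g) lambda(s) L].

    - [diamond] preserves Hilbert-Schmidt products: concatenating the images
      under the [iota_s] of an orthonormal basis of [W] gives an orthonormal
      basis of the induced space, so the product upstairs is the sum over [s]
      of the products of the restrictions to [iota_s W] ([hs_dot_ind]). Each of
      these [|S|] terms is [|S|^-1] times the product downstairs, because
      [lambda(s)] is unitary.

    - [diamond] is injective because [L] is recovered from [diamond L] as
      [w |-> |S|^(1/2) diamond L (iota_1 w)]. It is surjective because the same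
      recipe ([codiamond]) applied to an intertwiner [T] gives a preimage: [T]
      is determined on each [iota_s W] by its restriction to [iota_1 W],
      through [iota_s w = tau(s) (iota_1 w)]. *)

Local Open Scope ring_scope.

Section FrobeniusReciprocity.

Import Order.TTheory GRing.Theory Num.Theory.
Set Implicit Arguments.
Unset Strict Implicit.
Unset Printing Implicit Defensive.

Variables (C : numClosedFieldType) (G : finGroupType).

(** * The summands of the induced space *)

Section Summands.

Variables (S : {set G}) (W : vectType C).
Implicit Types (s t : {s | s \in S}) (w : ind_space S W).

Fact ind_single_linear s : linear (@ind_single C G S W s).
Proof.
move=> a x y; apply/ffunP => t; rewrite !ffunE.
by case: eqP => // _; rewrite scaler0 addr0.
Qed.

HB.instance Definition _ s :=
  GRing.isLinear.Build C _ _ _ (@ind_single C G S W s) (ind_single_linear s).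

Lemma ind_sum_single w : w = \sum_s ind_single s (w s).
Proof.
apply/ffunP => t; rewrite sum_ffunE (bigD1 t) //= ffunE eqxx big1 ?addr0 //.
by move=> s st; rewrite ffunE eq_sym (negPf st).
Qed.

Lemma eq_lfun_single (V : vectType C) (A B : 'Hom(ind_space S W, V)) :
  (forall s x, A (ind_single s x) = B (ind_single s x)) -> A = B.
Proof.
move=> AB; apply/lfunP => w; rewrite (ind_sum_single w) !linear_sum.
by apply: eq_bigr => s _; apply: AB.
Qed.

Variable formW : {dot W for Num.conj}.
Let formInd : {dot ind_space S W for Num.conj} := ffun_dot formW.

Lemma ffun_dot_single s t (x y : W) :
  formInd (ind_single s x) (ind_single t y) = formW x y *+ (s == t).
Proof.
rewrite /formInd /= /ffun_dot (bigD1 s) //= !ffunE eqxx big1 ?addr0.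
  by case: eqP => // _; rewrite linear0r.
by move=> u /negPf us; rewrite ffunE us linear0l.
Qed.

Lemma ind_single_inj s t (x y : W) : x != 0 ->
  (ind_single s x == ind_single t y) = (s == t) && (x == y).
Proof.
move=> x0; apply/eqP/andP=> [/ffunP/(_ s) | [/eqP-> /eqP->] //].
rewrite !ffunE eqxx; case: eqP => [_ -> // | _ x0E].
by rewrite x0E eqxx in x0.
Qed.

(** Different summands are orthogonal and each carries the form of [W], which
    gives orthonormality; the coordinates of each [w s] in [e] give spanning. *)
Lemma orthonormal_basis_single e : orthonormal_basis formW e ->
  orthonormal_basis formInd
    [seq ind_single s u | s <- index_enum {s | s \in S}, u <- e].
Proof.
case/andP=> be /orthonormalP[uniqe dote].
have e0 u : u \in e -> u != 0 by apply: basis_not0 be.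
set b := [seq _ | _ <- _, _ <- _]; suff ob: orthonormal formInd b.
  rewrite /orthonormal_basis ob /basis_of (orthonormal_free ob) !andbT.
  rewrite eqEsubv subvf; apply/subvP => w _.
  rewrite (ind_sum_single w); apply: memv_suml => s _.
  have /coord_span-> : w s \in <<in_tuple e>>%VS by rewrite (span_basis be) memvf.
  rewrite linear_sum; apply: memv_suml => i _; rewrite linearZ memvZ //.
  apply/memv_span/allpairsP; exists (s, e`_i).
  by rewrite mem_index_enum mem_nth.
apply/orthonormalP; split.
  apply: allpairs_uniq; rewrite ?index_enum_uniq //.
  move=> _ [t v] /allpairsP[[s u] /= [_ ue ->]] _ /= /eqP.
  by rewrite ind_single_inj ?e0 // => /andP[/eqP-> /eqP->].
move=> _ _ /allpairsP[[s u] /= [_ ue ->]] /allpairsP[[t v] /= [_ ve ->]].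
by rewrite ffun_dot_single dote // ind_single_inj ?e0 // -mulrnA mulnb andbC.
Qed.

Lemma hs_dot_ind (V : vectType C) (formV : {dot V for Num.conj})
    (A B : 'Hom(ind_space S W, V)) :
  hs_dot formInd formV A B =
  \sum_s \sum_(u <- onb formW) formV (A (ind_single s u)) (B (ind_single s u)).
Proof.
rewrite (hs_dotE formV A B (orthonormal_basis_single (onbP formW))).
by rewrite big_allpairs_dep.
Qed.

End Summands.

(** * Intertwiners and coset representatives *)

Lemma intertwinersP (H : {set G}) (V1 V2 : vectType C)
    (rho1 : G -> 'End(V1)) (rho2 : G -> 'End(V2)) (A : 'Hom(V1, V2)) :
  reflect {in H, forall h v, A (rho1 h v) = rho2 h (A v)}
          (A \in intertwiners H rho1 rho2).
Proof.
apply: (iffP forall_inP) => [AH h hH v | AH h hH].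
  by have /eqP/lfunP/(_ v) := AH h hH; rewrite !comp_lfunE.
by apply/eqP/lfunP => v; rewrite !comp_lfunE AH.
Qed.

Lemma transversal_lcosets_factor (H : {group G}) (S : {set G}) (g : G) :
    is_transversal S (lcosets H [set: G]) [set: G] ->
  exists s : {s | s \in S}, exists2 h, h \in H & g = (val s * h)%g.
Proof.
case/and3P=> _ _ /'forall_implyP trS.
have /trS/cards1P[s Ss] : (g *: H)%g \in lcosets H [set: G].
  by apply/lcosetsP; exists g; rewrite ?inE.
have /setIP[sS sg] : s \in S :&: (g *: H)%g by rewrite Ss set11.
exists (Sub s sS), (s^-1 * g)%g; last by rewrite SubK mulKVg.
by rewrite -mem_lcoset lcoset_sym.
Qed.

(** * The permutation representation *)

Section PermutationRepresentation.

Variables (X : finType) (to : {action G &-> X}).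
Let lambda : G -> 'End(fun_space C X) := perm_repr C to.
Let formLX : {dot fun_space C X for Num.conj} := ffun_dot (scalar_dot (C := C)).

Lemma perm_repr1 f : lambda 1%g f = f.
Proof. by apply/ffunP => x; rewrite perm_reprE invg1 lact1. Qed.

Lemma perm_reprM g h f : lambda (g * h)%g f = lambda g (lambda h f).
Proof. by apply/ffunP => x; rewrite !perm_reprE invMg lactM. Qed.

Lemma perm_repr_isometry g : isometry formLX formLX (lambda g).
Proof.
move=> f1 f2; rewrite /formLX /= /ffun_dot [RHS](reindex (lact to g^-1)) /=.
  by apply: eq_bigr => x _; rewrite !perm_reprE.
by exists (lact to g) => x _; rewrite -lactM ?mulgV ?mulVg lact1.
Qed.

(** * Lifting intertwiners to the induced space *)

Variables (H : {group G}) (S : {set G}) (W : vectType C).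
Variables (formW : {dot W for Num.conj}) (rho : G -> 'End(W)).
Let formInd : {dot ind_space S W for Num.conj} := ffun_dot formW.
Let tau : G -> 'End(ind_space S W) := ind_repr H S rho.

Lemma diamond_single (L : 'Hom(W, fun_space C X)) s u :
  diamond to S L (ind_single s u) =
    (sqrtC #|S|%:R)^-1 *: lambda (val s) (L u).
Proof.
apply/ffunP => x; rewrite diamondE ffunE perm_reprE; congr (_ * _).
rewrite (bigD1 s) //= ffunE eqxx big1 ?addr0 // => t /negPf ts.
by rewrite ffunE ts linear0 ffunE.
Qed.

Lemma diamond_linear : linear (@diamond C G X to S W).
Proof.
move=> a L M; apply: eq_lfun_single => s u.
rewrite add_lfunE scale_lfunE !diamond_single add_lfunE scale_lfunE linearP.
by rewrite scalerDr !scalerA mulrC.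
Qed.

Hypothesis transvS : is_transversal S (lcosets H [set: G]) [set: G].

Lemma diamond_intertwiner L : L \in intertwiners H rho lambda ->
  diamond to S L \in intertwiners [set: G] tau lambda.
Proof.
move=> /intertwinersP LH; apply/intertwinersP => g _ w; move: w.
suff E: (diamond to S L \o tau g)%VF = (lambda g \o diamond to S L)%VF.
  by move=> w; have /lfunP/(_ w) := E; rewrite !comp_lfunE.
apply: eq_lfun_single => s u; rewrite !comp_lfunE.
have [s' [h hH gs]] := transversal_lcosets_factor (g * val s) transvS.
rewrite /tau (ind_repr_single rho u transvS hH gs) !diamond_single linearZ /=.
by rewrite LH // -!perm_reprM gs.
Qed.

Hypothesis S1 : 1%g \in S.
Let one_S : {s | s \in S} := Sub 1%g S1.

Let sqrt_card_neq0 : sqrtC #|S|%:R != 0 :> C.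
Proof. by rewrite sqrtC_eq0 pnatr_eq0 -lt0n; apply/card_gt0P; exists 1%g. Qed.

(** Each of the [|S|] summands contributes [|S|^-1] times the product on the
    right, which is what the factor [|S|^(-1/2)] in [diamond] is for. *)
Lemma hs_dot_diamond L M :
  hs_dot formInd formLX (diamond to S L) (diamond to S M) =
  hs_dot formW formLX L M.
Proof.
set c : C := (sqrtC #|S|%:R)^-1.
have cc : c * c^* = #|S|%:R^-1.
  by rewrite -normCK ger0_norm ?invr_ge0 ?sqrtC_ge0 ?ler0n // exprVn sqrtCK.
have S0 : #|S|%:R != 0 :> C by rewrite -(sqrtCK #|S|%:R) expf_neq0.
rewrite hs_dot_ind (eq_bigr (fun=> #|S|%:R^-1 * hs_dot formW formLX L M)).
  rewrite sumr_const card_sig -[#|[pred _ | _]|]/#|S|.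
  by rewrite -[LHS]mulr_natl mulVKf.
move=> s _; rewrite mulr_sumr; apply: eq_bigr => u _.
rewrite !diamond_single linearZl_LR linearZr_LR /= mulrA cc.
by rewrite perm_repr_isometry.
Qed.

(** Evaluation on the summand of the coset [H] undoes [diamond] up to the
    normalizing factor. *)
Definition codiamond (T : 'Hom(ind_space S W, fun_space C X)) :
    'Hom(W, fun_space C X) :=
  (sqrtC #|S|%:R *: (T \o linfun (ind_single one_S)))%VF.

Lemma codiamondE T u :
  codiamond T u = sqrtC #|S|%:R *: T (ind_single one_S u).
Proof. by rewrite scale_lfunE comp_lfunE lfunE. Qed.

Lemma diamondK : cancel (@diamond C G X to S W) codiamond.
Proof.
move=> L; apply/lfunP => u; rewrite codiamondE diamond_single.
by rewrite scalerKV // perm_repr1.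
Qed.

(** The coset representatives translate the summand of [H] onto all the others,
    so that an intertwiner is determined on [iota_1 W]. *)
Lemma ind_repr_single1 s u : rho 1%g = \1%VF ->
  tau (val s) (ind_single one_S u) = ind_single s u.
Proof.
move=> rho1.
have := ind_repr_single (s := one_S) (s' := s) rho u transvS (group1 H).
by rewrite /tau rho1 id_lfunE; apply.
Qed.

Lemma codiamond_intertwiner T : T \in intertwiners [set: G] tau lambda ->
  codiamond T \in intertwiners H rho lambda.
Proof.
move=> /intertwinersP TG; apply/intertwinersP => h hH u.
rewrite !codiamondE linearZ /= -TG ?inE // /tau.
rewrite (ind_repr_single (s' := one_S) rho u transvS hH) //.
by rewrite mulg1 mul1g.
Qed.

Lemma codiamondK T : rho 1%g = \1%VF ->
  T \in intertwiners [set: G] tau lambda -> diamond to S (codiamond T) = T.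
Proof.
move=> rho1 /intertwinersP TG; apply: eq_lfun_single => s u.
rewrite diamond_single codiamondE linearZ /= scalerK //.
by rewrite -TG ?inE // ind_repr_single1.
Qed.

End PermutationRepresentation.

End FrobeniusReciprocity.

Theorem proposition2p17 (R : realType)
    (G : finGroupType) (X : finType) (to : {action G &-> X})
    (transX : [transitive [set: G], on [set: X] | to])
    (H : {group G}) (W : vectType R[i]) (formW : {dot W for Num.conj})
    (rho : G -> 'End(W)) (rhoP : unitary_repr H formW rho)
    (S : {set G})
    (transvS : is_transversal S (lcosets H [set: G]) [set: G])
    (S1 : 1%g \in S) :
  let formLX : {dot fun_space R[i] X for Num.conj} :=
    ffun_dot (scalar_dot (C := R[i])) in
  let formInd : {dot ind_space S W for Num.conj} := ffun_dot formW in
  let lambda : G -> 'End(fun_space R[i] X) := perm_repr R[i] to in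
  let tau : G -> 'End(ind_space S W) := ind_repr H S rho in
  let HomH : {pred 'Hom(W, fun_space R[i] X)} :=
    intertwiners H rho lambda in
  let HomG : {pred 'Hom(ind_space S W, fun_space R[i] X)} :=
    intertwiners [set: G] tau lambda in
  (forall L, L \in HomH -> diamond to S L \in HomG) /\
  isometric_isomorphism (hs_dot formW formLX) (hs_dot formInd formLX)
    HomH HomG (diamond to S).
Proof.
move=> formLX formInd lambda tau HomH HomG; have [rho1 _ _] := rhoP.
have diamondHom L : L \in HomH -> diamond to S L \in HomG.
  exact: diamond_intertwiner.
split=> //; split=> //.
- by move=> a L M _ _; apply: diamond_linear.
- by move=> L M _ _; apply: can_inj (diamondK to S1) L M.
- move=> T TG; exists (codiamond S1 T); first exact: codiamond_intertwiner.
  exact: (codiamondK transvS S1 rho1 TG).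
by move=> L M _ _; apply: hs_dot_diamond.
Qed.
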